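(* Let $f$ satisfy $(\mathcal A)$ and let $p\ge1$. Let $x_0,y_{-1},y_0\in\mathcal H$ with $y_0\neq y_{-1}$, let $\tau_0=0$, and define recursively for $k\ge0$ $$\lambda_k=\|y_k-y_{k-1}\|^{-\frac{p-1}{p}},\quad y_{k+1}=\operatorname{prox}_{\lambda_k f}(y_k),\quad \tau_{k+1}=\tau_k+\lambda_k,\quad x_{k+1}=\Big(1-\frac{\lambda_k}{\tau_{k+1}}\Big)x_k+\frac{\lambda_k}{\tau_{k+1}}y_{k+1},$$ and assume $\nabla f(y_k)\neq0$ for all $k\ge0$. Then $f(x_k)-\inf_{\mathcal H}f=O\big(k^{-(2-\frac1p)}\big)$ as $k\to+\infty$, and $(x_k)_{k\ge0}$ converges weakly to an element of $S=\operatorname{argmin} f$.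
   Context: $\mathcal H$ is a real Hilbert space. Assumption $(\mathcal A)$: $f:\mathcal H\to\mathbb R$ is convex and continuously differentiable, $S=\operatorname{argmin}_{\mathcal H} f\neq\emptyset$, and $\nabla f$ is Lipschitz continuous on bounded subsets of $\mathcal H$. For $\lambda>0$, $\operatorname{prox}_{\lambda f}(y)=\operatorname{argmin}_{u\in\mathcal H}\{f(u)+\frac{1}{2\lambda}\|u-y\|^2\}$. *)

(* Defs.v *)
From HB Require Import structures.
From mathcomp Require Import all_boot all_order all_algebra.
From mathcomp Require Import all_classical all_reals all_analysis.
Set Implicit Arguments. Unset Strict Implicit. Unset Printing Implicit Defensive.
Import Order.TTheory GRing.Theory Num.Theory.
Import numFieldNormedType.Exports.
Local Open Scope classical_set_scope.
Local Open Scope ring_scope.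

(* A real Hilbert space is a complete normed space V whose norm comes from an
   inner product [inner]: symmetric, linear in the first argument, and
   inner x x = |x|^2. *)
Definition is_inner_product {R : realType} {V : normedModType R}
  (inner : V -> V -> R) : Prop :=
  (forall x y : V, inner x y = inner y x) /\
  (forall (a : R) (x y z : V), inner (a *: x + y) z = a * inner x z + inner y z) /\
  (forall x : V, inner x x = `|x| ^+ 2).

Definition convex_fun {R : realType} {V : normedModType R} (f : V -> R) : Prop :=
  forall (x y : V) (t : R), 0 <= t -> t <= 1 ->
    f (t *: x + (1 - t) *: y) <= t * f x + (1 - t) * f y.

Definition is_gradient {R : realType} {V : normedModType R}
  (inner : V -> V -> R) (f : V -> R) (gf : V -> V) : Prop :=
  forall x : V, differentiable f x /\ ('d f x : V -> R) = (fun h => inner (gf x) h).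

Definition lipschitz_on_bounded {R : realType} {V : normedModType R}
  (g : V -> V) : Prop :=
  forall r : R, exists L : R, forall x y : V,
    `|x| <= r -> `|y| <= r -> `|g x - g y| <= L * `|x - y|.

Definition is_minimizer {R : realType} {V : normedModType R} (f : V -> R) (z : V) : Prop :=
  forall v : V, f z <= f v.

Definition assumption_A {R : realType} {V : normedModType R}
  (inner : V -> V -> R) (f : V -> R) (gf : V -> V) : Prop :=
  [/\ convex_fun f, is_gradient inner f gf, continuous gf,
      (exists z, is_minimizer f z) & lipschitz_on_bounded gf].

Definition is_prox {R : realType} {V : normedModType R} (f : V -> R)
  (lam : R) (y u : V) : Prop :=
  forall v : V, f u + (2 * lam)^-1 * `|u - y| ^+ 2 <= f v + (2 * lam)^-1 * `|v - y| ^+ 2.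

(* Main.v *)
Require Import Defs.
From mathcomp Require Import all_boot all_order all_algebra.
From mathcomp Require Import all_classical all_reals all_analysis.
From mathcomp Require Import ring lra.
Set Implicit Arguments. Unset Strict Implicit. Unset Printing Implicit Defensive.
Import Order.TTheory GRing.Theory Num.Theory.
Import numFieldNormedType.Exports.
Local Open Scope classical_set_scope.
Local Open Scope ring_scope.

(**
  Write [q := (p - 1) / p], [g k := gf (y k)], and let [z] minimize [f].  The
  optimality condition of the proximal step is [y k - y k.+1 = lam k *: g k.+1].
  Convexity makes the two energies
    [tau k ^+ 2 * `|g k| ^+ 2 + 2 * tau k * (f (y k) - f z) + `|y k - z| ^+ 2] and
    [2 * tau k * (f (x k) - f z) + `|y k - z| ^+ 2]
  nonincreasing.  The second gives [f (x k) - f z = O(1 / tau k)].  The first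
  gives [`|g k| <= C / tau k], so that [`|y k.+1 - y k| <= C * lam k / tau k.+1];
  as [lam k.+1] is the power [- q] of the left-hand side, this is a discrete
  version of [tau' ^ (1 + q) >= c * tau ^ q], whence
  [tau k >= c * k ^ (1 + q)], with [1 + q = 2 - 1 / p].

  The sequence [y] is Fejer monotone with respect to the minimizers and
  [f (y k)] tends to [f z], so [y] converges weakly to a minimizer by Opial's
  argument; [x] is a weighted mean of [y] with weights of divergent sum, hence
  has the same weak limit.
*)

(** * Algebra of the inner product and Cauchy-Schwarz *)

Section InnerProduct.
Variables (R : realType) (V : normedModType R) (inner : V -> V -> R).
Hypothesis inner_ip : is_inner_product inner.

Lemma innerC (u v : V) : inner u v = inner v u.
Proof. by case: inner_ip. Qed.

Lemma innerDl (u v w : V) : inner (u + v) w = inner u w + inner v w.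
Proof.
by case: inner_ip => _ [lin _]; rewrite -[u in LHS]scale1r lin mul1r.
Qed.

Lemma inner0l (w : V) : inner 0 w = 0.
Proof.
by have := innerDl 0 0 w; rewrite addr0 => /eqP; rewrite addrC -subr_eq subrr
  => /eqP.
Qed.

Lemma innerZl (a : R) (u w : V) : inner (a *: u) w = a * inner u w.
Proof.
by case: inner_ip => _ [lin _]; rewrite -[a *: u]addr0 lin inner0l addr0.
Qed.

Lemma innerNl (u w : V) : inner (- u) w = - inner u w.
Proof. by rewrite -scaleN1r innerZl mulN1r. Qed.

Lemma innerBl (u v w : V) : inner (u - v) w = inner u w - inner v w.
Proof. by rewrite innerDl innerNl. Qed.

Lemma innerDr (u v w : V) : inner w (u + v) = inner w u + inner w v.
Proof. by rewrite innerC innerDl !(innerC w). Qed.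

Lemma innerZr (a : R) (u w : V) : inner w (a *: u) = a * inner w u.
Proof. by rewrite innerC innerZl innerC. Qed.

Lemma innerNr (u w : V) : inner w (- u) = - inner w u.
Proof. by rewrite innerC innerNl innerC. Qed.

Lemma innerBr (u v w : V) : inner w (u - v) = inner w u - inner w v.
Proof. by rewrite innerDr innerNr. Qed.

Lemma innerxx (u : V) : inner u u = `|u| ^+ 2.
Proof. by case: inner_ip => _ [_]. Qed.

Lemma sqr_normD (u v : V) :
  `|u + v| ^+ 2 = `|u| ^+ 2 + 2 * inner u v + `|v| ^+ 2.
Proof.
by rewrite -!innerxx innerDl !innerDr (innerC v u); ring.
Qed.

Lemma sqr_normB (u v : V) :
  `|u - v| ^+ 2 = `|u| ^+ 2 - 2 * inner u v + `|v| ^+ 2.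
Proof. by rewrite sqr_normD innerNr normrN mulrN. Qed.

(** The norm of [V] comes with its triangle inequality; squaring it and cancelling the squares
    leaves Cauchy-Schwarz. *)
Lemma inner_le (u v : V) : inner u v <= `|u| * `|v|.
Proof.
have := ler_normD u v.
rewrite -(ler_pXn2r (n := 2)) ?nnegrE ?addr_ge0 ?normr_ge0// sqr_normD.
by rewrite sqrrD -mulr_natl; lra.
Qed.

Lemma normr_inner_le (u v : V) : `|inner u v| <= `|u| * `|v|.
Proof.
by rewrite ler_norml inner_le lerNl -innerNl andbT (le_trans (inner_le _ _))// normrN.
Qed.

Lemma inner_inj (u v : V) : (forall w, inner u w = inner v w) -> u = v.
Proof.
move=> uv; apply/eqP; rewrite -subr_eq0 -normr_eq0 -sqrf_eq0 -innerxx.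
by rewrite innerBl uv subrr.
Qed.

End InnerProduct.

(** * First-order conditions from convexity, weak limits and proximal steps *)

Section Gradient.
Variables (R : realType) (V : normedModType R) (inner : V -> V -> R).
Hypothesis inner_ip : is_inner_product inner.
Variables (f : V -> R) (gf : V -> V).
Hypothesis gradf : is_gradient inner f gf.

Lemma gradient_quotient (u h : V) (e : R) : 0 < e ->
  exists2 d, 0 < d & forall t, 0 < t -> t < d ->
    `|inner (gf u) h - t^-1 * (f (u + t *: h) - f u)| < e.
Proof.
move=> e0; have [df dfE] := gradf u.
have : t^-1 *: ((f \o shift u) (t *: h) - f u) @[t --> 0^'] --> 'D_h f u.
  exact: diff_derivable.
rewrite deriveE// dfE => /cvgrPdist_lt/(_ e e0)[d /= d0 dP].
exists d => // t t0 td; rewrite [u + _]addrC.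
by apply: dP; rewrite ?gt_eqF//= sub0r normrN gtr0_norm.
Qed.

(** After division by [t] the quadratic term vanishes as [t] tends to 0. It is allowed here to
    absorb the penalty of a proximal step. *)
Lemma gradient_ge (u h : V) (a b : R) :
  (forall t, 0 < t -> t <= 1 -> a * t + b * t ^+ 2 <= f (u + t *: h) - f u) ->
  a <= inner (gf u) h.
Proof.
move=> quad; rewrite leNgt; apply/negP => ga.
pose e := (a - inner (gf u) h) / 2.
have e0 : 0 < e by rewrite divr_gt0// subr_gt0.
have [d d0 dP] := gradient_quotient u h e0.
have b0 : 0 < `|b| + 1 by rewrite ltr_wpDl.
(* For this [t] the difference quotient is at least [a - e], yet below [inner (gf u) h + e], which
   is the same number. *)
pose t := Num.min (d / 2) (Num.min 1 (e / (`|b| + 1))).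
have d20 : 0 < d / 2 by rewrite divr_gt0.
have eb0 : 0 < e / (`|b| + 1) by rewrite divr_gt0.
have t0 : 0 < t by rewrite /t !lt_min d20 ltr01 eb0.
have t1 : t <= 1 by rewrite /t !ge_min lexx !orbT.
have td : t < d by rewrite /t !gt_min ltr_pdivrMr// ltr_pMr// ltr1n.
have tb : t * (`|b| + 1) <= e by rewrite -ler_pdivlMr// /t !ge_min lexx !orbT.
have := dP t t0 td; rewrite ltr_norml => /andP[dP1 _].
have := quad t t0 t1; rewrite -(ler_pM2l (_ : 0 < t^-1)) ?invr_gt0//.
have -> : t^-1 * (a * t + b * t ^+ 2) = a + b * t by field; rewrite gt_eqF.
have : - (`|b| * t) <= b * t.
  by rewrite -mulNr ler_pM2r// lerNl ler_normr lexx orbT.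
move: dP1 tb; rewrite /e; nra.
Qed.

Lemma gradient_le (u h : V) (a : R) :
  (forall t, 0 < t -> t <= 1 -> f (u + t *: h) - f u <= a * t) ->
  inner (gf u) h <= a.
Proof.
move=> lin; rewrite leNgt; apply/negP; rewrite -subr_gt0 => e0.
have [d d0 dP] := gradient_quotient u h e0.
pose t := Num.min (d / 2) 1.
have t0 : 0 < t by rewrite /t lt_min ltr01 divr_gt0.
have t1 : t <= 1 by rewrite /t !ge_min lexx orbT.
have td : t < d by rewrite /t !gt_min ltr_pdivrMr// ltr_pMr// ltr1n.
have := dP t t0 td; rewrite ltr_norml => /andP[_ dP1].
have := lin t t0 t1; rewrite -(ler_pM2l (_ : 0 < t^-1)) ?invr_gt0//.
have -> : t^-1 * (a * t) = a by field; rewrite gt_eqF.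
by move: dP1; lra.
Qed.

Lemma convex_gradient_le (u v : V) : convex_fun f ->
  f u + inner (gf u) (v - u) <= f v.
Proof.
move=> cf; suff : inner (gf u) (v - u) <= f v - f u by lra.
apply: gradient_le => t t0 t1.
have -> : u + t *: (v - u) = t *: v + (1 - t) *: u.
  by rewrite scalerBl scale1r scalerBr addrCA addrA.
by have := cf v u t (ltW t0) t1; lra.
Qed.

(** The tangent of [f] at [xi], evaluated at [y k], lies below [f (y k)] and tends to [f xi] by weak
    convergence; hence [f xi <= f z]. *)
Lemma minimizer_of_weak_limit (F : set_system nat) {FF : ProperFilter F}
    (y : nat -> V) (xi z : V) : convex_fun f -> is_minimizer f z ->
  f (y k) @[k --> F] --> f z ->
  (forall w, inner (y k) w @[k --> F] --> inner xi w) -> is_minimizer f xi.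
Proof.
move=> cf zmin fy yxi v; apply: le_trans (zmin v).
have cv : f xi + (inner (y k) (gf xi) - inner xi (gf xi)) @[k --> F] -->
    f xi + (inner xi (gf xi) - inner xi (gf xi)).
  by apply: cvgD; [exact: cvg_cst | apply: cvgB; [exact: yxi | exact: cvg_cst]].
rewrite -[leLHS]addr0 -(subrr (inner xi (gf xi))).
apply: (ler_cvg_to cv fy); near=> k.
rewrite -(innerBl inner_ip) (innerC inner_ip).
exact: convex_gradient_le.
Unshelve. all: by end_near. Qed.

Lemma prox_gradient (lam : R) (y u : V) : 0 < lam ->
  is_prox f lam y u -> y - u = lam *: gf u.
Proof.
move=> lam0 px.
have ge0 h : inner (lam^-1 *: (y - u)) h <= inner (gf u) h.
  apply: (@gradient_ge _ _ _ (- ((2 * lam)^-1 * `|h| ^+ 2))) => t t0 t1.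
  have := px (u + t *: h).
  have -> : u + t *: h - y = (u - y) + t *: h by rewrite addrAC.
  rewrite (sqr_normD inner_ip (u - y)) normrZ exprMn (innerZr inner_ip).
  rewrite (innerZl inner_ip) -(opprB y u) (innerNl inner_ip) real_normK ?num_real//.
  rewrite invfM; move: (`|- _| ^+ 2) (`|h| ^+ 2) (inner (y - u) h) => A B C.
  have -> : lam^-1 * C * t = 2^-1 / lam * (2 * (t * C)) by field; rewrite gt_eqF.
  lra.
(* Both sides are linear in [h], so the inequality at [- h] is the reverse one. *)
have eq h : inner (lam^-1 *: (y - u)) h = inner (gf u) h.
  apply/eqP; rewrite eq_le ge0/=; have := ge0 (- h).
  by rewrite !(innerNr inner_ip) lerN2.
by rewrite -(inner_inj inner_ip eq) scalerA divff ?gt_eqF// scale1r.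
Qed.

End Gradient.

(** * Compactness along ultrafilters, Riesz representation and Opial's lemma *)

Lemma ultra_cvg_bounded (R : realType) (T : Type) (F : set_system T)
    (b : T -> R) (M : R) :
  UltraFilter F -> (forall k, `|b k| <= M) -> exists l : R, b k @[k --> F] --> l.
Proof.
move=> UF bM; have PF := @ultra_proper _ _ UF.
have FM : F (b @^-1` `[- M, M]%classic).
  apply: filterE => k; rewrite /= in_itv/= -ler_norml. exact: bM.
have [l [_ lcl]] := @segment_compact R (- M) M (b @ F) _ FM.
exists l => A lA; have [//|FnA] := in_ultra_setVsetC (b @^-1` A) UF.
by have [t [/= nAt At]] := lcl (~` A) A FnA lA.
Qed.

Section Hilbert.
Variables (R : realType) (V : completeNormedModType R) (inner : V -> V -> R).
Hypothesis inner_ip : is_inner_product inner.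

Lemma cvg_innerl (T : Type) (F : set_system T) {FF : Filter F}
    (u : T -> V) (xi w : V) :
  u k @[k --> F] --> xi -> inner (u k) w @[k --> F] --> inner xi w.
Proof.
move=> uxi; apply/cvgrPdist_lt => e e0.
have w0 : 0 < `|w| + 1 by rewrite ltr_wpDl.
have /cvgrPdist_lt/(_ _ (divr_gt0 e0 w0)) := uxi.
apply: filterS => k; rewrite ltr_pdivlMr// => uk.
rewrite -(innerBl inner_ip); apply: le_lt_trans (normr_inner_le inner_ip _ _) _.
by apply: le_lt_trans uk; rewrite ler_wpM2l// lerDl.
Qed.

(** The representing vector minimizes [J]: the parallelogram identity makes a minimizing sequence
    Cauchy, and the first variation of [J] at its limit vanishes. *)
Lemma riesz_representation (L : V -> R) (M : R) :
  (forall a u v, L (a *: u + v) = a * L u + L v) ->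
  (forall v, `|L v| <= M * `|v|) ->
  exists xi, forall w, L w = inner xi w.
Proof.
move=> Llin LM; pose J v := `|v| ^+ 2 - 2 * L v.
have lbJ : has_lbound (range J).
  exists (- M ^+ 2) => _ [v _ <-]; rewrite /J.
  have := LM v; rewrite ler_norml => /andP[_].
  have := sqr_ge0 (`|v| - M); nra.
pose m := inf (range J).
have mJ v : m <= J v by apply: ge_inf => //; exists v.
have infJ : has_inf (range J) by split => //; exists (J 0), 0.
have /choice[u uP] : forall n, exists u, J u < m + harmonic n.
  move=> n; have hn : 0 < harmonic n :> R by rewrite invr_gt0 ltr0n.
  by have [_ [v _ <-] ?] := inf_adherent hn infJ; exists v.
have LD a b : L (a + b) = L a + L b by rewrite -[a in LHS]scale1r Llin mul1r.
have L0 : L 0 = 0.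
  by have := LD 0 0; rewrite addr0 => /eqP; rewrite addrC -subr_eq subrr => /eqP.
have LZ a b : L (a *: b) = a * L b by rewrite -[_ *: _]addr0 Llin L0 addr0.
have parallelogram a b : `|a - b| ^+ 2 <= 2 * (J a - m) + 2 * (J b - m).
  have := mJ (2^-1 *: (a + b)); rewrite /J LZ LD normrZ exprMn.
  rewrite (sqr_normB inner_ip) (sqr_normD inner_ip) real_normK ?num_real//.
  lra.
have : cvg (u @ \oo).
  apply: cauchy_cvg; apply: cauchy_exP => e e0.
  have e20 : 0 < e ^+ 2 / 4 by rewrite divr_gt0// exprn_gt0.
  have /cvgrPdist_lt/(_ _ e20)[N _ NP] := @cvg_harmonic R.
  exists (u N); exists N => // n /= Nn.
  rewrite -ball_normE /ball_ /= -(ltr_pXn2r (n := 2)) ?nnegrE ?normr_ge0 ?(ltW e0)//.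
  apply: le_lt_trans (parallelogram _ _) _.
  have := NP n Nn; have := NP N (leqnn N).
  rewrite !sub0r !normrN !ger0_norm ?invr_ge0 ?ler0n//.
  by have := uP n; have := uP N; lra.
move=> /cvg_ex[/= xi uxi]; exists xi => w.
have variation t : 0 <= 2 * t * (inner xi w - L w) + t ^+ 2 * `|w| ^+ 2.
  have cv : 2 * t * (inner (u k) w - L w) + t ^+ 2 * `|w| ^+ 2 + harmonic k
      @[k --> \oo] --> 2 * t * (inner xi w - L w) + t ^+ 2 * `|w| ^+ 2 + 0.
    apply: cvgD; last exact: cvg_harmonic.
    apply: cvgD; last exact: cvg_cst.
    apply: cvgM; first exact: cvg_cst.
    by apply: cvgB; [exact: cvg_innerl | exact: cvg_cst].
  rewrite -[leRHS]addr0.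
  apply: (ler_cvg_to (cvg_cst 0) cv); apply: nearW => k.
  have := mJ (u k + t *: w); have := uP k; rewrite /J LD LZ (sqr_normD inner_ip).
  by rewrite (innerZr inner_ip) normrZ exprMn real_normK ?num_real//; lra.
set c := inner xi w - L w in variation.
suff : c ^+ 2 <= 0.
  by rewrite exprn_even_le0//= subr_eq0 => /eqP.
(* Near-optimal step for the variation; the [+ 1] covers [w = 0]. With [t = - (s * c)] the variation
   is at most [- s * c ^+ 2], forcing [c = 0]. *)
pose s := (`|w| ^+ 2 + 1)^-1.
have w0 : 0 < `|w| ^+ 2 + 1 by rewrite ltr_wpDl// sqr_ge0.
have s0 : 0 < s by rewrite invr_gt0.
have sw : s * `|w| ^+ 2 <= 1 by rewrite mulrC ler_pdivrMr// mul1r lerDl.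
have := variation (- (s * c)).
have -> : 2 * - (s * c) * c + (- (s * c)) ^+ 2 * `|w| ^+ 2 =
   s * (- (c ^+ 2 * (2 - s * `|w| ^+ 2))) by ring.
rewrite pmulr_rge0// oppr_ge0 => h.
by have := sqr_ge0 c; nra.
Qed.

(** Each bounded real sequence [inner (y k) w] converges along [F]; the limits form a bounded linear
    functional of [w], which Riesz represents. *)
Lemma ultra_weak_cvg (F : set_system nat) (y : nat -> V) (M : R) :
  UltraFilter F -> (forall k, `|y k| <= M) ->
  exists xi, forall w, inner (y k) w @[k --> F] --> inner xi w.
Proof.
move=> UF yM; have PF := @ultra_proper _ _ UF.
have bd w k : `|inner (y k) w| <= M * `|w|.
  by apply: le_trans (normr_inner_le inner_ip _ _) _; rewrite ler_wpM2r.
have /choice[L LP] : forall w, exists l : R, inner (y k) w @[k --> F] --> l.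
  by move=> w; apply: (ultra_cvg_bounded (M := M * `|w|)) => // k; exact: bd.
have [xi xiP] : exists xi, forall w, L w = inner xi w.
  apply: (@riesz_representation _ M).
    move=> a u v; apply: (cvg_unique (@Rhausdorff R) (LP _)).
    rewrite (_ : (fun k => _) = fun k => a * inner (y k) u + inner (y k) v).
      by apply: cvgD => //; apply: cvgM => //; exact: cvg_cst.
    by apply/funext => k; rewrite (innerDr inner_ip) (innerZr inner_ip).
  move=> v; rewrite ler_norml; apply/andP; split.
    have cst : - (M * `|v|) @[_ --> F] --> - (M * `|v|) by exact: cvg_cst.
    apply: (ler_cvg_to cst (LP v)); near=> k.
    by have := bd v k; rewrite ler_norml => /andP[].
  have cst : M * `|v| @[_ --> F] --> M * `|v| by exact: cvg_cst.
  apply: (ler_cvg_to (LP v) cst); near=> k.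
  by have := bd v k; rewrite ler_norml => /andP[].
by exists xi => w; rewrite -xiP.
Unshelve. all: by end_near. Qed.

(* Subsequences are replaced by ultrafilters finer than [\oo], so no
   separability or diagonal extraction is needed. *)
Lemma opial (S : set V) (y : nat -> V) (M : R) :
  (forall k, `|y k| <= M) ->
  (forall z, S z -> cvg (`|y k - z| @[k --> \oo])) ->
  (forall F : set_system nat, ProperFilter F -> \oo `<=` F ->
     forall xi, (forall w, inner (y k) w @[k --> F] --> inner xi w) -> S xi) ->
  exists xi, S xi /\ forall w, inner (y k) w @[k --> \oo] --> inner xi w.
Proof.
move=> yM dist clusterS.
have ultra_limit U : UltraFilter U -> \oo `<=` U ->
    exists xi, S xi /\ forall w, inner (y k) w @[k --> U] --> inner xi w.
  move=> UU sub; have [xi xiP] := ultra_weak_cvg UU yM.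
  exists xi; split => //; exact: (clusterS U).
have ultra_unique U U' xi xi' : ProperFilter U -> ProperFilter U' ->
    \oo `<=` U -> \oo `<=` U' -> S xi -> S xi' ->
    (forall w, inner (y k) w @[k --> U] --> inner xi w) ->
    (forall w, inner (y k) w @[k --> U'] --> inner xi' w) -> xi = xi'.
  move=> PU PU' sU sU' Sxi Sxi' lim lim'.
  have /cvg_ex[/= d dP] := dist _ Sxi; have /cvg_ex[/= d' dP'] := dist _ Sxi'.
  (* The difference of the squared distances to [xi] and [xi'] is affine in
     [inner (y k) (xi - xi')], which therefore converges along the whole sequence. Testing both weak
     limits on [xi - xi'] gives [c] twice. *)
  pose c := 2^-1 * (d' * d' - d * d + (`|xi| ^+ 2 - `|xi'| ^+ 2)).
  have cP : inner (y k) (xi - xi') @[k --> \oo] --> c.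
    rewrite (_ : (fun k => _) = fun k => 2^-1 * (`|y k - xi'| * `|y k - xi'|
      - `|y k - xi| * `|y k - xi| + (`|xi| ^+ 2 - `|xi'| ^+ 2))).
      apply: cvgM; first exact: cvg_cst.
      by apply: cvgD; [apply: cvgB; apply: cvgM | exact: cvg_cst].
    apply/funext => k; rewrite -!expr2 !(sqr_normB inner_ip) (innerBr inner_ip).
    by field.
  have e1 : inner xi (xi - xi') = c.
    apply: (cvg_unique (@Rhausdorff R) (lim _)).
    exact: cvg_trans (cvg_app _ sU) cP.
  have e2 : inner xi' (xi - xi') = c.
    apply: (cvg_unique (@Rhausdorff R) (lim' _)).
    exact: cvg_trans (cvg_app _ sU') cP.
  apply/eqP; rewrite -subr_eq0 -normr_eq0 -sqrf_eq0 -(innerxx inner_ip).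
  by rewrite (innerBl inner_ip) e1 e2 subrr.
have [U [UU sU]] := ultraFilterLemma eventually_filter.
have [xi [Sxi xiP]] := ultra_limit U UU sU.
exists xi; split=> // w; apply/cvgrPdist_lt => e e0.
apply: contrapT => nfar.
(* If convergence fails at [w], the bad indices [A] meet every tail, so some ultrafilter finer than
   [\oo] contains [A]; its weak limit is again [xi], a contradiction. *)
pose A := [set k | ~ (`|inner xi w - inner (y k) w| < e)].
have PA : ProperFilter (within A \oo).
  apply: Build_ProperFilter => W; apply: nfar.
  by move: W; apply: (@filterS _ \oo) => k /= Ak; apply: contrapT => /Ak.
have [U' [UU' sU']] := ultraFilterLemma PA.
have sU'' : \oo `<=` U'.
  by move=> B B_; apply: sU'; apply: (@filterS _ \oo) B_ => k.
have U'A : U' A by apply: sU'; apply: (@filterE _ \oo) => k.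
have [xi' [Sxi' xiP']] := ultra_limit U' UU' sU''.
have exi : xi = xi'.
  exact: (ultra_unique U U' xi xi' (@ultra_proper _ _ UU) (@ultra_proper _ _ UU')).
have PU' := @ultra_proper _ _ UU'.
have := xiP' w; rewrite -exi => /cvgrPdist_lt/(_ _ e0) near_e.
apply: (filter_not_empty U'); apply: filterS (filterI U'A near_e).
by move=> k [].
Qed.

End Hilbert.

(** * Weighted means and growth of the sums of steps *)

Section WeightedMeans.
Variables (R : realType) (lam tau : nat -> R).
Hypothesis lam_gt0 : forall k, 0 < lam k.
Hypothesis tau0 : tau 0%N = 0.
Hypothesis tauS : forall k, tau k.+1 = tau k + lam k.

Lemma partial_sum_ge0 k : 0 <= tau k.
Proof.
elim: k => [|k IH]; first by rewrite tau0.
by rewrite tauS addr_ge0// ltW.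
Qed.

Lemma partial_sum_gt0 k : 0 < tau k.+1.
Proof. by rewrite tauS ltr_wpDl// partial_sum_ge0. Qed.

Lemma partial_sum_le m n : (m <= n)%N -> tau m <= tau n.
Proof.
move=> /subnK <-; elim: (n - m)%N => // k IH.
by rewrite addSn tauS; have := lam_gt0 (k + m)%N; lra.
Qed.

Lemma weighted_mean_cvg (a b : nat -> R) (l : R) :
  tau k @[k --> \oo] --> +oo ->
  (forall k, a k.+1 = (1 - lam k / tau k.+1) * a k + lam k / tau k.+1 * b k.+1) ->
  b k @[k --> \oo] --> l -> a k @[k --> \oo] --> l.
Proof.
move=> tauy aS bl; apply/cvgrPdist_le => e e0.
have e20 : 0 < e / 2 by rewrite divr_gt0.
have /cvgrPdist_le/(_ _ e20)[N _ NP] := bl.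
(* Multiplied by [tau], the recursion for [a] becomes additive, so errors accumulate: a fixed head
   up to [N], then at most [e / 2] per unit of weight. *)
have acc k : tau (k + N)%N * `|l - a (k + N)%N| <=
    tau N * `|l - a N| + e / 2 * (tau (k + N)%N - tau N).
  elim: k => [|k IH]; first by rewrite add0n subrr mulr0 addr0.
  have t0 := partial_sum_gt0 (k + N)%N.
  have bk : `|l - b (k + N)%N.+1| <= e / 2 by apply: NP => /=; rewrite leqW// leq_addl.
  rewrite addSn -[X in X * _]gtr0_norm// -normrM.
  have -> : tau (k + N)%N.+1 * (l - a (k + N)%N.+1) =
      tau (k + N)%N * (l - a (k + N)%N) + lam (k + N)%N * (l - b (k + N)%N.+1).
    rewrite aS; have := tauS (k + N)%N; move: t0; set T := tau _.+1 => t0 TE.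
    rewrite (_ : tau (k + N)%N = T - lam (k + N)%N); last by rewrite TE addrK.
    by field; rewrite gt_eqF.
  apply: le_trans (ler_normD _ _) _; rewrite !normrM (gtr0_norm (lam_gt0 _)).
  rewrite (ger0_norm (partial_sum_ge0 _)) tauS.
  by have := lam_gt0 (k + N)%N; nra.
have /cvgryPge/(_ (tau N * `|l - a N| / (e / 2))) near_tau := tauy.
near=> k.
have Nk : (N < k)%N by near: k; exact: nbhs_infty_gt.
have : tau N * `|l - a N| / (e / 2) <= tau k by near: k.
rewrite ler_pdivrMr// => tk.
have := acc (k - N)%N; rewrite subnK ?(ltnW Nk)//.
have tk0 : 0 < tau k by rewrite -(ltn_predK Nk) partial_sum_gt0.
have := mulr_ge0 (ltW e20) (partial_sum_ge0 N) => tN acck.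
rewrite -(ler_pM2l tk0); lra.
Unshelve. all: by end_near. Qed.

End WeightedMeans.

(* Sampling at even indices copes with the fact that [d k.+1] involves [lam k]
   while [lam k.+1] is a power of [d k.+1]: in each pair of steps either [lam k]
   is already large, or it is small, which makes [d k.+1] small and hence
   [lam k.+1] large. *)
Lemma step_sum_growth (R : realType) (q D : R) (d lam tau : nat -> R) :
  0 <= q -> q <= 1 -> 0 < D ->
  (forall k, 0 < d k) -> (forall k, lam k = d k `^ (- q)) ->
  tau 0%N = 0 -> (forall k, tau k.+1 = tau k + lam k) ->
  (forall k, d k.+1 * tau k.+1 <= D * lam k) ->
  exists2 A, 0 < A & forall n, (1 < n)%N -> A * n%:R `^ (1 + q) <= tau n.
Proof.
move=> q0 q1 D0 d0 lamE tau0 tauS dtau.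
have lam_gt0 k : 0 < lam k by rewrite lamE powR_gt0.
have q10 : 0 <= 1 + q by lra.
have D3 : 0 < 3 * D by rewrite mulr_gt0.
have D3q : 0 < (3 * D) `^ q by rewrite powR_gt0.
(* The first bound starts the induction at [k = 1]; the second serves the case where [lam m.*2] is
   small. *)
pose A := Num.min (tau 2%N) (((3 * D) `^ q)^-1 / 3).
have A0 : 0 < A by rewrite lt_min (partial_sum_gt0 lam_gt0)// divr_gt0// invr_gt0.
have A1 : A <= tau 2%N by rewrite ge_min lexx.
have A2 : A * 3 <= ((3 * D) `^ q)^-1 by rewrite -ler_pdivlMr// ge_min lexx orbT.
have even k : (0 < k)%N -> A * k%:R `^ (1 + q) <= tau k.*2.
  elim: k => // -[_ _|k IH _]; first by rewrite powR1 mulr1.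
  rewrite doubleS; move: IH => /(_ isT); set m := k.+1; set K : R := m%:R => IH.
  have K1 : 1 <= K by rewrite ler1n.
  have K0 : 0 < K by rewrite ltr0n.
  set P := K `^ q; have P0 : 0 < P by rewrite powR_gt0.
  have KP : K `^ (1 + q) = K * P.
    by rewrite powRD ?(powRr1 (ltW K0))// (gt_eqF K0) implybT.
  (* Since [1 + q <= 2] and [K >= 1], the power grows by at most [3 * P]; two steps thus need to add
     only [3 * A * P] to [tau]. *)
  have K2 : m.+1%:R `^ (1 + q) <= K * P + 3 * P.
    have -> : m.+1%:R = K * (1 + K^-1) by rewrite mulrDr mulr1 divff ?gt_eqF// natr1.
    have Ki : K^-1 <= 1 by rewrite invf_le1.
    have Ki0 : 0 < K^-1 by rewrite invr_gt0.
    rewrite powRM ?(ltW K0)//; last by lra.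
    rewrite KP; have pow2 : (1 + K^-1) `^ (1 + q) <= (1 + K^-1) ^+ 2.
      by rewrite -powR_mulrn; [apply: ler_powR; lra | lra].
    apply: (@le_trans _ _ (K * P * (1 + K^-1) ^+ 2)).
      by rewrite ler_pM2l ?mulr_gt0.
    have -> : K * P * (1 + K^-1) ^+ 2 = K * P + P * (2 + K^-1).
      by field; rewrite gt_eqF.
    by rewrite lerD2l mulrC ler_pM2r//; lra.
  suff lam2 : 3 * A * P <= lam m.*2 + lam m.*2.+1.
    rewrite -(ler_pM2l A0) in K2; rewrite 2!tauS.
    by move: IH K2; rewrite KP; lra.
  have [lam_ge|lam_lt] := lerP (3 * A * P) (lam m.*2).
    by apply: le_trans lam_ge _; rewrite lerDl ltW.
  have tau_ge : A * (K * P) <= tau m.*2.+1.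
    by rewrite -KP (le_trans IH)// tauS lerDl ltW.
  have d_le : d m.*2.+1 <= 3 * D / K.
    rewrite ler_pdivlMr// -(ler_pM2r (mulr_gt0 A0 P0)).
    have := dtau m.*2; move: tau_ge; rewrite -(ler_pM2l (d0 m.*2.+1)).
    by move: lam_lt; rewrite -(ltr_pM2l D0); lra.
  have DK0 : 0 < 3 * D / K by rewrite divr_gt0.
  have lam_ge : 3 * A * P <= lam m.*2.+1.
    rewrite lamE powRN.
    have : d m.*2.+1 `^ q <= (3 * D / K) `^ q.
      by apply: ge0_ler_powR; rewrite ?nnegrE ?(ltW DK0) ?(ltW (d0 _)).
    rewrite -lef_pV2 ?posrE ?powR_gt0// => /(le_trans _); apply.
    have -> : ((3 * D / K) `^ q)^-1 = ((3 * D) `^ q)^-1 * P.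
      rewrite -[in RHS](divfK (lt0r_neq0 K0) (3 * D)) (powRM q (ltW DK0) (ltW K0)).
      by rewrite -/P; field; rewrite !gt_eqF ?powR_gt0.
    by rewrite ler_pM2r// mulrC.
  by apply: le_trans lam_ge _; rewrite lerDr ltW.
(* Passing to odd indices costs a factor 9: [n] is at most three times [n./2] once [n > 1], and
   [1 + q <= 2]. *)
exists (A / 9); first by rewrite divr_gt0.
move=> n n1; have n20 : (0 < n./2)%N by rewrite half_gt0.
apply: le_trans (partial_sum_le lam_gt0 tauS (_ : (n./2.*2 <= n)%N)); last first.
  by rewrite -[leqRHS]odd_double_half leq_addl.
apply: le_trans (even _ n20).
have n3 : n%:R <= 3 * (n./2)%:R :> R.
  rewrite -natrM ler_nat -[leqLHS]odd_double_half -muln2 mulnC.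
  by rewrite (mulnDl 1 2) mul1n leq_add// (leq_trans (leq_b1 _)).
have : n%:R `^ (1 + q) <= (3 * (n./2)%:R) `^ (1 + q) :> R.
  by apply: ge0_ler_powR; rewrite ?nnegrE ?mulr_ge0.
rewrite powRM//; have : 3 `^ (1 + q) <= 9 :> R.
  have -> : 9 = 3 `^ 2%:R :> R by rewrite powR_mulrn//; lra.
  by rewrite ler_powR//; lra.
have := powR_ge0 ((n./2)%:R : R) (1 + q).
move: (_ `^ _) (3 `^ _) (n%:R `^ _) => a b c a0 b9 cab.
by rewrite mulrAC ler_pdivrMr// -mulrA ler_pM2l//; nra.
Qed.

(** * Descent and energy estimates for the proximal iteration *)

Section ProximalPoint.
Variables (R : realType) (V : normedModType R) (inner : V -> V -> R).
Variables (f : V -> R) (gf : V -> V) (lam tau : nat -> R) (x y : nat -> V).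
Hypothesis inner_ip : is_inner_product inner.
Hypothesis cvxf : convex_fun f.
Hypothesis gradf : is_gradient inner f gf.
Hypothesis lam_gt0 : forall k, 0 < lam k.
Hypothesis tau0 : tau 0%N = 0.
Hypothesis tauS : forall k, tau k.+1 = tau k + lam k.
Hypothesis prox_y : forall k, is_prox f (lam k) (y k) (y k.+1).
Hypothesis xS : forall k,
  x k.+1 = (1 - lam k / tau k.+1) *: x k + (lam k / tau k.+1) *: y k.+1.

Lemma prox_step k : y k - y k.+1 = lam k *: gf (y k.+1).
Proof. exact: (prox_gradient inner_ip gradf). Qed.

Lemma prox_decrease k : f (y k.+1) + lam k * `|gf (y k.+1)| ^+ 2 <= f (y k).
Proof.
have := convex_gradient_le gradf (y k.+1) (y k) cvxf.
by rewrite prox_step (innerZr inner_ip) (innerxx inner_ip).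
Qed.

(** The tangent inequalities at [y k] and [y k.+1] together bound the squared norm of the new
    gradient by its inner product with the old one; Cauchy-Schwarz concludes. *)
Lemma prox_gradient_norm_le k : `|gf (y k.+1)| <= `|gf (y k)|.
Proof.
have [->|g0] := eqVneq (gf (y k.+1)) 0; first by rewrite normr0.
have h1 := prox_decrease k.
have := convex_gradient_le gradf (y k) (y k.+1) cvxf.
rewrite -opprB prox_step (innerNr inner_ip) (innerZr inner_ip) => h2.
have : lam k * `|gf (y k.+1)| ^+ 2 <= lam k * inner (gf (y k)) (gf (y k.+1)) by lra.
rewrite ler_pM2l// => /le_trans/(_ (inner_le inner_ip _ _)).
by rewrite expr2 ler_pM2r// normr_gt0.
Qed.

(** Expand the square around [y k.+1]; convexity between [y k.+1] and [z] bounds the cross term from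
    below. *)
Lemma prox_dist_le (z : V) k :
  `|y k.+1 - z| ^+ 2 + 2 * lam k * (f (y k.+1) - f z)
    + lam k ^+ 2 * `|gf (y k.+1)| ^+ 2 <= `|y k - z| ^+ 2.
Proof.
have -> : y k - z = (y k.+1 - z) + lam k *: gf (y k.+1).
  by rewrite -prox_step [RHS]addrC addrA subrK.
rewrite (sqr_normD inner_ip (_ - z)) normrZ exprMn real_normK ?num_real//.
rewrite lerD2r lerD2l.
rewrite (innerZr inner_ip) (innerC inner_ip) mulrA ler_pM2l ?mulr_gt0//.
have := convex_gradient_le gradf (y k.+1) z cvxf.
by rewrite -opprB (innerNr inner_ip); lra.
Qed.

(** Add [prox_dist_le], [2 * tau k] times [prox_decrease], and [tau k ^+ 2] times the decrease of
    the squared gradient norm: the gradient coefficients add up to [(tau k + lam k) ^+ 2]. *)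
Lemma prox_energy_le (z : V) k : is_minimizer f z ->
  tau k ^+ 2 * `|gf (y k)| ^+ 2 + 2 * tau k * (f (y k) - f z)
    + `|y k - z| ^+ 2 <= `|y 0%N - z| ^+ 2.
Proof.
move=> zmin; elim: k => [|k]; first by rewrite tau0 expr0n/= mulr0 !mul0r !add0r.
apply: le_trans; have := prox_dist_le z k; rewrite tauS.
have t0 := partial_sum_ge0 lam_gt0 tau0 tauS k.
have : tau k * (f (y k.+1) + lam k * `|gf (y k.+1)| ^+ 2) <= tau k * f (y k).
  by rewrite ler_wpM2l// prox_decrease.
have : tau k ^+ 2 * `|gf (y k.+1)| ^+ 2 <= tau k ^+ 2 * `|gf (y k)| ^+ 2.
  by rewrite ler_wpM2l ?sqr_ge0// lerXn2r ?nnegrE ?prox_gradient_norm_le.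
lra.
Qed.

(** Convexity along the averaging step, multiplied by [tau k.+1], has weights [tau k] and [lam k];
    the latter's gap is paid for by [prox_dist_le]. *)
Lemma prox_average_energy_le (z : V) k : is_minimizer f z ->
  2 * tau k * (f (x k) - f z) + `|y k - z| ^+ 2 <= `|y 0%N - z| ^+ 2.
Proof.
move=> zmin; elim: k => [|k]; first by rewrite tau0 mulr0 mul0r add0r.
apply: le_trans; have := prox_dist_le z k.
have t0 := partial_sum_ge0 lam_gt0 tau0 tauS k.
have T0 := partial_sum_gt0 lam_gt0 tau0 tauS k.
have Tle : lam k / tau k.+1 <= 1 by rewrite ler_pdivrMr// mul1r tauS lerDr.
have Tge : 0 <= lam k / tau k.+1 by rewrite divr_ge0// ltW.
have : tau k.+1 * f (x k.+1) <= tau k * f (x k) + lam k * f (y k.+1).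
  have := @cvxf (x k) (y k.+1) (1 - lam k / tau k.+1).
  rewrite subr_ge0 gerBl (subKr 1) -xS => /(_ Tle Tge).
  rewrite -(ler_pM2l T0) => /le_trans; apply.
  have -> : tau k = tau k.+1 - lam k by rewrite tauS addrK.
  by rewrite le_eqVlt; apply/orP; left; apply/eqP; field; rewrite gt_eqF.
have := mulr_ge0 (sqr_ge0 (lam k)) (sqr_ge0 `|gf (y k.+1)|).
rewrite tauS; lra.
Qed.

End ProximalPoint.

(* y k stands for y_k (k >= 0), ym1 for y_{-1}; lam k = lambda_k, tau k = tau_k. *)
Theorem mainTheorem15 (R : realType) (V : completeNormedModType R)
  (inner : V -> V -> R) (f : V -> R) (gf : V -> V) (p : R)
  (x y : nat -> V) (ym1 : V) (lam tau : nat -> R) :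
  is_inner_product inner ->
  assumption_A inner f gf ->
  1 <= p ->
  y 0%N != ym1 ->
  tau 0%N = 0 ->
  (forall k : nat, lam k =
     (`|y k - (if k is k'.+1 then y k' else ym1)|) `^ (- ((p - 1) / p))) ->
  (forall k : nat, is_prox f (lam k) (y k) (y k.+1)) ->
  (forall k : nat, tau k.+1 = tau k + lam k) ->
  (forall k : nat, x k.+1 =
     (1 - lam k / tau k.+1) *: x k + (lam k / tau k.+1) *: y k.+1) ->
  (forall k : nat, gf (y k) != 0) ->
  (exists C : R, \forall k \near \oo,
      f (x k) - inf (range f) <= C * (k%:R `^ (- (2 - p^-1))))
  /\
  (exists xs : V, is_minimizer f xs /\
      forall z : V, (fun k => inner (x k) z) @ \oo --> inner xs z).
Proof.
move=> ip [cvxf gradf _ [z zmin] _] p1 y0 tau0 lamE prox_y tauS xS g0.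
pose d k := `|y k - (if k is k'.+1 then y k' else ym1)|.
pose q := (p - 1) / p.
have p0 : 0 < p by lra.
have qE : q = 1 - p^-1 by rewrite /q; field; rewrite gt_eqF.
have pV0 : 0 < p^-1 by rewrite invr_gt0.
have pV1 : p^-1 <= 1 by rewrite invf_le1.
(* Positivity matters because [lam k] is a negative power of [d k]; nonzero gradients propagate
   it. *)
have d_gt0 k : 0 < d k.
  elim: k => [|k dk]; first by rewrite normr_gt0 subr_eq0.
  have lk : 0 < lam k by rewrite lamE powR_gt0.
  rewrite /d distrC (prox_gradient ip gradf lk (prox_y k)) normr_gt0.
  by rewrite scaler_eq0 negb_or (gt_eqF lk) g0.
have lam_gt0 k : 0 < lam k by rewrite lamE powR_gt0// d_gt0.
have energy k := prox_energy_le ip cvxf gradf lam_gt0 tau0 tauS prox_y k zmin.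
pose D := `|y 0%N - z| + 1.
have D0 : 0 < D by rewrite ltr_wpDl.
have tau_ge0 := partial_sum_ge0 lam_gt0 tau0 tauS.
(* By [prox_step], [d k.+1] is [lam k] times a gradient norm, and the first term of the energy
   bounds that norm by [D / tau k.+1]. *)
have dtau k : d k.+1 * tau k.+1 <= D * lam k.
  rewrite /d distrC (prox_step ip gradf lam_gt0 prox_y) normrZ gtr0_norm//.
  rewrite -mulrA mulrC ler_pM2r// mulrC.
  apply: (@le_trans _ _ `|y 0%N - z|); last by rewrite lerDl.
  rewrite -(ler_pXn2r (n := 2)) ?nnegrE ?mulr_ge0// exprMn.
  apply: le_trans (energy k.+1); rewrite -addrA lerDl addr_ge0 ?sqr_ge0//.
  by rewrite !mulr_ge0// subr_ge0.
have [A A0 AP] : exists2 A, 0 < A &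
    forall n, (1 < n)%N -> A * n%:R `^ (1 + q) <= tau n.
  by apply: (step_sum_growth _ _ D0 d_gt0 lamE tau0 tauS dtau); rewrite -/q qE; lra.
have tauy : tau k @[k --> \oo] --> +oo.
  apply/cvgryPge => B.
  have /cvgryPge/(_ (B / A)) nearB := @cvgr_idn R.
  near=> k.
  have k1 : (1 < k)%N by near: k; exact: nbhs_infty_gt.
  have : B / A <= k%:R by near: k.
  rewrite ler_pdivrMr// mulrC => /le_trans; apply.
  apply: le_trans (AP k k1); rewrite ler_pM2l//.
  rewrite -[leLHS]powRr1// ler_powR ?ler1n ?(ltnW k1)//.
  by rewrite qE; lra.
split.
  have infE : f z <= inf (range f).
    by apply: lb_le_inf => [|_ [v _ <-]]; [exists (f z), z | exact: zmin].
  exists (`|y 0%N - z| ^+ 2 / A); near=> n.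
  have n1 : (1 < n)%N by near: n; exact: nbhs_infty_gt.
  have n0 : 0 < n%:R `^ (1 + q) by rewrite powR_gt0// ltr0n ltnW.
  have -> : 2 - p^-1 = 1 + q by rewrite qE; lra.
  rewrite powRN -mulrA -invfM ler_pdivlMr ?mulr_gt0//.
  apply: (@le_trans _ _ ((f (x n) - f z) * tau n)).
    apply: (@le_trans _ _ ((f (x n) - f z) * (A * n%:R `^ (1 + q)))).
      by rewrite ler_pM2r ?mulr_gt0// lerD2l lerN2.
    by rewrite ler_wpM2l ?subr_ge0 ?zmin// AP.
  have := prox_average_energy_le ip cvxf gradf lam_gt0 tau0 tauS prox_y xS n zmin.
  have := sqr_ge0 `|y n - z|; have := tau_ge0 n.
  have : 0 <= f (x n) - f z by rewrite subr_ge0.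
  by nra.
(* Fejer monotonicity, the first hypothesis on distances in Opial's lemma. *)
have dist_cvg v : is_minimizer f v -> cvg (`|y k - v| @[k --> \oo]).
  move=> vmin; apply: nonincreasing_is_cvgn; last by exists 0 => _ [k _ <-].
  apply/nonincreasing_seqP => k; rewrite -(ler_pXn2r (n := 2)) ?nnegrE//.
  apply: le_trans (prox_dist_le ip cvxf gradf lam_gt0 prox_y v k).
  rewrite -addrA lerDl addr_ge0// ?mulr_ge0 ?sqr_ge0// ?(ltW (lam_gt0 k))//.
  by rewrite subr_ge0.
have y_bounded k : `|y k| <= `|y 0%N - z| + `|z|.
  rewrite -[X in `|X|](subrK z) (le_trans (ler_normD _ _))// lerD2r.
  rewrite -(ler_pXn2r (n := 2)) ?nnegrE//.
  apply: le_trans (energy k); rewrite lerDr addr_ge0//.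
    by rewrite mulr_ge0 ?sqr_ge0.
  by rewrite !mulr_ge0// subr_ge0.
have fy : f (y k) @[k --> \oo] --> f z.
  (* The middle term of the energy bounds the gap by a constant over [tau k]. *)
  apply/cvgrPdist_le => e e0.
  have /cvgryPge/(_ (`|y 0%N - z| ^+ 2 / e)) near_tau := tauy.
  near=> k; rewrite distrC ger0_norm ?subr_ge0//.
  have : `|y 0%N - z| ^+ 2 / e <= tau k by near: k.
  have k0 : (0 < k)%N by near: k; exact: nbhs_infty_gt.
  have tk0 : 0 < tau k by rewrite -(ltn_predK k0) (partial_sum_gt0 lam_gt0).
  rewrite ler_pdivrMr// => tk; rewrite -(ler_pM2l tk0).
  have := energy k; have := sqr_ge0 `|y k - z|.
  have := mulr_ge0 (sqr_ge0 (tau k)) (sqr_ge0 `|gf (y k)|).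
  have : 0 <= tau k * (f (y k) - f z) by rewrite mulr_ge0// subr_ge0.
  by lra.
have [xs [xsmin yxs]] : exists xs, is_minimizer f xs /\
    forall w, inner (y k) w @[k --> \oo] --> inner xs w.
  apply: (opial ip y_bounded dist_cvg) => F PF sF xi xiP.
  apply: (minimizer_of_weak_limit ip gradf cvxf zmin _ xiP).
  exact: cvg_trans (cvg_app _ sF) fy.
exists xs; split=> // w.
(* Pairing with [w] turns the recursion for [x] into a scalar weighted mean. *)
apply: (weighted_mean_cvg lam_gt0 tau0 tauS tauy _ (yxs w)) => k /=.
by rewrite xS (innerDl ip) !(innerZl ip).
Unshelve. all: by end_near. Qed.
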